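(* Let $n\ge1$ and $m\ge 1$ be integers, let $S\subseteq[m]$, and for each $s\in S$ let $\Gamma_s=([n],A_s)$ be a simple digraph. Put $\Gamma_\bullet=(\Gamma_s)_{s\in S}$ and let $$\mathcal C_n^{m,S}(\Gamma_\bullet)=\mathcal C_n^m\setminus\{x_i-x_j=s\mid s\in S,\ (i,j)\in A_s\},$$ an arrangement in $\mathbb R^n$. Then $$\chi(\mathcal C_n^{m,S}(\Gamma_\bullet),t)=t\sum_F\bigl(t-W(F)-m\,c(F)-1\bigr)^{\underline{c(F)-1}},$$ where the sum is over all admissible sets $F$ of deleted gain-labeled arcs.
   Context: Notation: $[n]=\{1,\dots,n\}$. Falling factorial: $x^{\underline r}=x(x-1)\cdots(x-r+1)$, $x^{\underline 0}=1$. A simple digraph has no loops and no repeated arcs (both $(i,j)$ and $(j,i)$ may be present). The full $m$-Catalan arrangement in $\mathbb R^n$ is the set of hyperplanes $$\mathcal C_n^m=\{x_i-x_j=0\mid 1\le i<j\le n\}\cup\{x_i-x_j=s\mid 1\le i\ne j\le n,\ 1\le s\le m\}.$$ For a finite hyperplane arrangement $\mathcal A$ in $\mathbb R^n$, $L(\mathcal A)$ is the poset of nonempty intersections of subfamilies of $\mathcal A$, ordered by reverse inclusion, with minimum $\hat 0=\mathbb R^n$ (the empty intersection). With $\mu$ the Möbius function of $L(\mathcal A)$, the characteristic polynomial is $\chi(\mathcal A,t)=\sum_{X\in L(\mathcal A)}\mu(\hat 0,X)t^{\dim X}$. A deleted gain-labeled arc is a triple $(i,j;s)$ with $s\in S$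 and $(i,j)\in A_s$. A set $F$ of deleted gain-labeled arcs is viewed as a spanning gain graph on $[n]$ (parallel triples with distinct gains $s$ allowed). Its weak components are the connected components of $[n]$ when orientations and gains are ignored (isolated vertices count as components); $V(C)$ is the vertex set of a weak component $C$. The set $F$ is admissible if: (1) on every weak component $C$ there is an integer potential $\phi_C:V(C)\to\mathbb Z$ satisfying $\phi_C(i)-\phi_C(j)=s$ for every $(i,j;s)\in F$ lying in $C$; (2) the values of $\phi_C$ are distinct on $V(C)$; (3) if $u,v\in V(C)$, $u\neq v$, and $\phi_C(u)-\phi_C(v)\in[1,m]$, then $(u,v;\phi_C(u)-\phi_C(v))\in F$. (The potential on each weak component is unique up to an additive constant.) For admissible $F$, the span of a weak component $C$ is $w(C)=\max_{v\in V(C)}\phi_C(v)-\min_{v\in V(C)}\phi_C(v)$; $c(F)$ is the number of weak components of $F$, including isolated vertices; and $W(F)=\sum_C w(C)$, summed over all weak components. *)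

(* Defs.v *)
From HB Require Import structures.
From mathcomp Require Import all_boot all_order all_algebra finmap.
From mathcomp Require Import boolp classical_sets functions reals.
Set Implicit Arguments.
Unset Strict Implicit.
Unset Printing Implicit Defensive.
Import Order.TTheory GRing.Theory Num.Theory.
Local Open Scope fset_scope.
Local Open Scope classical_set_scope.
Local Open Scope ring_scope.

Definition ffactr (R : pzRingType) (x : R) (r : nat) : R :=
  \prod_(i < r) (x - i%:R).

Section Mobius.
Context {T : choiceType}.
Variables (L : {fset T}) (le : rel T).

Fixpoint mobius_rec (k : nat) (x y : T) : int :=
  if k isn't k'.+1 then 0 else
  if x == y then 1 else
  if le x y then
    - \sum_(z <- L | [&& le x z, le z y & z != y]) mobius_rec k' x z
  else 0.

(* Every chain of L has at most #|` L| elements, so this amount of fuel is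
   enough; see mobiusE. *)
Definition mobius (x y : T) : int := mobius_rec #|` L| x y.

Hypotheses (le_refl : reflexive le) (le_anti : antisymmetric le)
  (le_trans : transitive le).

Let down y := [fset z in L | le z y].

Lemma mobius_recE k x y : y \in L ->
  (#|` down y| <= k)%N -> mobius_rec k x y = mobius x y.
Proof.
have step k1 : forall k2 x' y', y' \in L -> (#|` down y'| <= k1)%N ->
    (#|` down y'| <= k2)%N -> mobius_rec k1 x' y' = mobius_rec k2 x' y'.
  elim: k1 => [|k1 IH] k2 x' y' y'L.
    rewrite leqn0 cardfs_eq0 => /eqP/fsetP/(_ y').
    by rewrite !inE /= y'L le_refl.
  have dpos : (0 < #|` down y'|)%N.
    by rewrite cardfs_gt0; apply/fset0Pn; exists y'; rewrite !inE /= y'L le_refl.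
  case: k2 => [|k2] h1 h2; first by rewrite leqNgt dpos in h2.
  rewrite /=; case: ifP => // _; case: ifP => // _; congr (- _).
  rewrite big_seq_cond [RHS]big_seq_cond; apply: eq_bigr => z.
  move=> /andP[zL /and3P[_ zy nzy]].
  have lt : (#|` down z| < #|` down y'|)%N.
    apply: fproper_ltn_card; rewrite fproperE; apply/andP; split.
      apply/fsubsetP => u; rewrite !inE /= => /andP[-> uz].
      exact: le_trans uz zy.
    apply/negP => /fsubsetP/(_ y'); rewrite !inE /= y'L le_refl /= => /(_ isT).
    by move=> yz; move/eqP: nzy; apply; apply: le_anti; rewrite zy yz.
  by apply: IH => //; rewrite -ltnS; apply: leq_trans lt _.
move=> yL hk; apply: step => //.
by apply: fsubset_leq_card; apply/fsubsetP => u; rewrite !inE => /andP[].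
Qed.

Lemma mobiusxx x : x \in L -> mobius x x = 1.
Proof.
move=> xL; rewrite /mobius.
case E : #|` L| => [|k] /=; last by rewrite eqxx.
by move/eqP: E; rewrite cardfs_eq0 => /eqP E; rewrite E inE in xL.
Qed.

Lemma mobiusE x y : x \in L -> y \in L -> le x y -> x != y ->
  \sum_(z <- L | le x z && le z y) mobius x z = 0.
Proof.
move=> xL yL xy nxy.
rewrite big_mkcond (big_fsetD1 y) //= xy le_refl /=.
have -> : mobius x y = mobius_rec #|` down y|.+1 x y.
  rewrite -(@mobius_recE #|` L| x y) //; last first.
    by apply: fsubset_leq_card; apply/fsubsetP => u; rewrite !inE => /andP[].
  by rewrite [RHS]mobius_recE.
rewrite /= (negbTE nxy) xy big_mkcond (big_fsetD1 y) //= eqxx !andbF add0r.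
apply/eqP; rewrite addrC subr_eq0; apply/eqP.
rewrite big_seq [RHS]big_seq; apply: eq_bigr => z.
rewrite !inE => /andP[-> zL]; rewrite andbT.
case: ifP => // /andP[xz zy]; rewrite mobius_recE //.
apply: fsubset_leq_card; apply/fsubsetP => u; rewrite !inE /=.
by move=> /andP[-> uz]; exact: le_trans uz zy.
Qed.

End Mobius.

Section Arrangement.
Context {R : realType} {n : nat}.
Implicit Types (X : set 'rV[R]_n) (U : {vspace 'rV[R]_n}).

(* The direction of an affine subspace x + U is U; meaningless on other sets. *)
Definition direction X : {vspace 'rV[R]_n} :=
  xget 0%VS [set U | exists x, X = [set x + u | u in [set` U]]].

Definition affdim X : nat := \dim (direction X).

Lemma affdimE (x : 'rV[R]_n) U : affdim [set x + u | u in [set` U]] = \dim U.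
Proof.
rewrite /affdim /direction; case: xgetP => [V _ [y e]|/(_ U)]; last first.
  by case; exists x.
congr (\dim _).
have memE z : (exists2 u, u \in U & x + u = z) <-> (exists2 v, v \in V & y + v = z).
  have : [set x + u | u in [set` U]] z = [set y + v | v in [set` V]] z.
    by rewrite e.
  by move=> /= E; split; [rewrite /= -[X in _ -> X]E|rewrite -[X in X -> _]E].
have [v0 v0V xE] : exists2 v, v \in V & y + v = x.
  by apply/memE; exists 0; rewrite ?mem0v ?addr0.
apply/vspaceP => u; apply/idP/idP => uM.
  have [|w wU] := (memE (x + u)).2; first by
    exists (v0 + u); rewrite ?memvD // addrA xE.
  by move/addrI <-.
have [|w wV] := (memE (x + u)).1; first by exists u.
rewrite -xE -addrA => /addrI wE.
by rewrite -[u](addKr v0) -wE addrC memvB.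
Qed.

Definition flats (A : {fset set 'rV[R]_n}) : {fset set 'rV[R]_n} :=
  [fset X in [fset \bigcap_(H in [set` B]) H | B : {fset set 'rV[R]_n} in fpowerset A] |
    X != set0].

Definition charpoly (A : {fset set 'rV[R]_n}) : {poly int} :=
  let L := flats A in
  \sum_(X <- L) mobius L (fun Y Z => `[< Z `<=` Y >]) setT X *: 'X^(affdim X).

Definition hyp (i j : 'I_n) (s : nat) : set 'rV[R]_n :=
  [set x | x ord0 i - x ord0 j = s%:R].

Definition catalan (m : nat) : {fset set 'rV[R]_n} :=
  ([fset hyp e.1 e.2 0 | e : 'I_n * 'I_n & (e.1 < e.2)%N] `|`
  [fset hyp e.1.1 e.1.2 (val e.2) |
    e : 'I_n * 'I_n * 'I_m.+1 & (e.1.1 != e.1.2) && (1 <= e.2)%N])%fset.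

End Arrangement.
Arguments catalan : clear implicits.

Section GainGraphs.
Context {n m : nat}.

(* (i, j, s) is the arc from i to j with gain s; 'I_m.+1 stands for
   {0, ..., m}, and label sets S below are meant not to contain 0. *)
Definition gain_arc : Type := ('I_n * 'I_n * 'I_m.+1)%type.
HB.instance Definition _ := Finite.on gain_arc.

Variables (S : {set 'I_m.+1}) (A : 'I_m.+1 -> rel 'I_n).

Definition deleted_arcs : {set gain_arc} :=
  [set e : gain_arc | (e.2 \in S) && A e.2 e.1.1 e.1.2].

Definition deleted_catalan (R : realType) : {fset set 'rV[R]_n} :=
  (catalan R n m `\` [fset hyp e.1.1 e.1.2 (val e.2) | e in deleted_arcs])%fset.

Implicit Types (F : {set gain_arc}) (C : {set 'I_n}) (phi : 'I_n -> int).

Definition adjacent F : rel 'I_n :=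
  fun i j => [exists s, ((i, j, s) \in F) || ((j, i, s) \in F)].

Definition wcomponents F : {set {set 'I_n}} :=
  equivalence_partition (connect (adjacent F)) [set: 'I_n].

(* Only the values of phi on C matter. *)
Definition potential F C phi : Prop :=
  forall i j s, (i, j, s) \in F -> i \in C -> j \in C ->
    phi i - phi j = s%:Z.

Definition admissible F : Prop :=
  F \subset deleted_arcs /\
  forall C, C \in wcomponents F -> exists phi,
    [/\ potential F C phi,
        {in C &, injective phi} &
        forall (u v : 'I_n) (s : 'I_m.+1), u \in C -> v \in C -> u != v ->
          (1 <= s)%N -> phi u - phi v = s%:Z -> (u, v, s) \in F].

Definition spread phi C : int :=
  let vals := [seq phi v | v in C] in
  \big[Order.max/head 0 vals]_(x <- vals) x
  - \big[Order.min/head 0 vals]_(x <- vals) x.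

(* Potentials on a weak component differ by an additive constant, so the spread
   does not depend on the one selected by xget. *)
Definition wspan F C : int := spread (xget (fun=> 0) (potential F C)) C.

Definition nb_components F : nat := #|wcomponents F|.

Definition total_span F : int := \sum_(C in wcomponents F) wspan F C.

End GainGraphs.
Arguments gain_arc : clear implicits.

(* Main.v *)
Require Import Defs.
From mathcomp Require Import all_boot all_order all_algebra finmap.
From mathcomp Require Import boolp classical_sets functions reals.
From mathcomp Require Import zify lra.
Set Implicit Arguments.
Unset Strict Implicit.
Unset Printing Implicit Defensive.
Import Order.TTheory GRing.Theory Num.Theory.
Local Open Scope ring_scope.

(** The proof is the finite field method, over the rings Z/q for all large q,
    prime or not.

    Both sides are polynomials, so it is enough to compare their values at all
    large integers q.  A residue vector p in (Z/q)^n is turned into an integer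
    vector by cutting the cycle Z/q open at a place followed by m free cells
    (m n < q makes room for one) and reading the residues from there.  After
    this lift a relation p_i - p_j = s mod q with 0 <= s <= m holds if and only
    if it holds between integers ([lift_cutE]), so the real hyperplanes through
    the lift are exactly those that p satisfies modulo q.  A flat of dimension
    d then contains the lifts of exactly q^d residue vectors
    ([card_flat_points]), and Moebius summation over the flats through a lift
    shows that the characteristic polynomial at q counts the residue vectors
    that satisfy no equation of the arrangement ([charpoly_count]).

    These vectors are sorted by the set F of gain-labeled arcs they satisfy:
    the coordinates are distinct, and F has to consist of deleted arcs, which
    makes it admissible, the lift being a potential ([avoid_deletedP],
    [admissible_arcs_of]).

    Conversely let F be admissible, with c components.  A vector whose arcs are
    those of F places each component C rigidly on the cycle, its shape given by
    the potential.  Inside a component consecutive potentials differ by at most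
    m ([anchored_gap]), so no vertex of another component can come within
    distance m of its hull without creating a new arc.  Hence the vectors
    correspond to placements of c disjoint labeled arcs of w(C) + m + 1 cells on
    a cycle of q cells.  Fixing the position of one of them contributes a factor
    q; shrinking every arc to a single cell turns the rest into injective
    placements of c - 1 cells among q - W(F) - m c - 1 ([card_placed],
    [card_realizing_points]), which is the summand of F. *)

(** * Evaluating the characteristic polynomial by counting *)

Lemma poly_eq_large (P Q : {poly int}) (N : nat) :
  (forall q, (N <= q)%N -> P.[q%:R] = Q.[q%:R]) -> P = Q.
Proof.
move=> PQ; apply/eqP; rewrite -subr_eq0; apply/negPn/negP => nz.
pose s := [seq (k%:R : int) | k <- iota N (size (P - Q))].
have us : uniq s.
  by rewrite map_inj_uniq ?iota_uniq // => a b /eqP; rewrite eqr_nat => /eqP.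
have rs : all (root (P - Q)) s.
  apply/allP => _ /mapP[k + ->]; rewrite mem_iota => /andP[Nk _].
  by rewrite /root hornerD hornerN PQ // subrr.
by have := max_poly_roots nz rs us; rewrite size_map size_iota ltnn.
Qed.

Section CharpolyCount.
Local Open Scope classical_set_scope.
Context {R : realType} {n : nat}.
Implicit Types (A B : {fset set 'rV[R]_n}) (X Y : set 'rV[R]_n).

Lemma flatsP A X :
  reflect (exists B, [/\ {subset B <= A}, X = \bigcap_(H in [set` B]) H
    & X != set0]) (X \in flats A).
Proof.
rewrite /flats !inE /=; apply: (iffP andP).
  case=> /imfsetP[B /=]; rewrite fpowersetE => /fsubsetP BA -> X0.
  by exists B.
case=> B [BA E X0]; split => //; apply/imfsetP; exists B => //=.
by rewrite fpowersetE; apply/fsubsetP.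
Qed.

(** The point [g p] lies on exactly those flats that contain Y, the intersection
    of all hyperplanes through [g p].  So writing q^dim X as a count of points
    and exchanging the sums leaves, for each p, the Moebius sum over the
    interval from the whole space to Y.  It vanishes unless Y is the whole
    space, that is, unless no hyperplane passes through [g p]. *)
Lemma charpoly_count A (T : finType) (g : T -> 'rV[R]_n) (q : nat) :
  setT \notin A ->
  (forall X, X \in flats A -> #|[set p | `[< X (g p) >]]%SET| = (q ^ affdim X)%N) ->
  (charpoly A).[q%:R] =
    #|[set p | `[< forall H, H \in A -> ~ H (g p) >]]%SET|%:R.
Proof.
move=> nTA cX; rewrite /charpoly; set L := flats A.
set le := fun Y Z : set _ => `[< Z `<=` Y >].
have le_refl : reflexive le by move=> Y; apply/asboolP.
have le_anti : antisymmetric le.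
  by move=> Y Z /andP[/asboolP a /asboolP b]; apply/seteqP; split.
have le_trans : transitive le.
  by move=> Y Z W /asboolP a /asboolP b; apply/asboolP => u /b /a.
have TL : setT \in L.
  apply/flatsP; exists fset0; split => //.
    by apply/esym/seteqP; split => // u _ H; rewrite /= inE.
  by apply/set0P; exists 0.
rewrite horner_sum.
transitivity (\sum_(X <- L) \sum_(p : T)
    (if `[< X (g p) >] then mobius L le setT X else 0)).
  rewrite big_seq [RHS]big_seq; apply: eq_bigr => X XL.
  rewrite hornerZ hornerXn -big_mkcond /= sumr_const.
  rewrite -natrX -(cX _ XL) mulr_natr; congr (_ *+ _).
  by apply: eq_card => p; rewrite !inE.
rewrite exchange_big /= -sum1_card natr_sum [RHS]big_mkcond /=.
apply: eq_bigr => p _.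
(* Y is the smallest flat containing g p. *)
set B := [fset H in A | `[< H (g p) >]]%fset.
set Y := \bigcap_(H in [set` B]) H.
have Yp : Y (g p) by move=> H /=; rewrite !inE => /andP[_ /asboolP].
have YL : Y \in L.
  apply/flatsP; exists B; split => //; last by apply/set0P; exists (g p).
  by move=> H; rewrite !inE => /andP[].
have YP X : X \in L -> `[< X (g p) >] = le X Y.
  case/flatsP => C [CA -> _]; apply/asboolP/asboolP.
    move=> Cp u Yu H HC; apply: Yu; rewrite /= !inE; apply/andP; split.
      by rewrite CA.
    by apply/asboolP; apply: Cp.
  by apply.
transitivity (\sum_(X <- L | le setT X && le X Y) mobius L le setT X).
  rewrite -big_mkcond big_seq_cond [RHS]big_seq_cond; apply: eq_bigl => X.
  case XL : (X \in L) => //=; rewrite YP //.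
  by have -> : le setT X by apply/asboolP.
rewrite inE; have [YT|YT] := eqVneq setT Y.
  have -> : `[< forall H, H \in A -> ~ H (g p) >].
    apply/asboolP => H HA Hp.
    case/negP: nTA; suff <- : H = setT by [].
    apply/seteqP; split => // u _; have : Y u by rewrite -YT.
    by apply; rewrite /= !inE; apply/andP; split => //; apply/asboolP.
  have lexx X : le X X by apply/asboolP.
  rewrite big_mkcond (big_fsetD1 setT) //= -YT !lexx /= (mobiusxx le TL).
  rewrite big1_seq ?addr0 // => X /=; rewrite !inE => /andP[/eqP nX _].
  by case: ifP => // /andP[_ /asboolP XT]; case: nX; apply/seteqP; split.
rewrite (mobiusE le_refl le_anti le_trans) //; last by apply/asboolP.
case: asboolP => // nA; case/eqP: YT; apply/esym/seteqP; split => // u _ H.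
by rewrite /= !inE => /andP[HA /asboolP]; case/(nA _ HA).
Qed.
End CharpolyCount.

(** * Cutting the cycle open *)

Section Lift.
Context {n q : nat}.
Implicit Types (p : {ffun 'I_n -> 'I_q.+2}).

(** A position on the cycle such that none of the [m] cells starting there is
    occupied; reading the cycle from it, every coordinate is at least [m]. *)
Definition cut (m : nat) p : 'I_q.+2 :=
  odflt 0 [pick a | [forall i, (m <= val (p i - a)%R)%N]].

(** Each of the [n] coordinates spoils [m] starting positions, fewer than the
    size of the cycle in total. *)
Lemma cutP m p : (n * m < q.+2)%N -> forall i, (m <= val (p i - cut m p)%R)%N.
Proof.
move=> nm; rewrite /cut; case: pickP => [a /forallP //|nex].
pose bad (e : 'I_n * 'I_m) : 'I_q.+2 := p e.1 - (val e.2)%:R.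
suff : [set: 'I_q.+2] \subset bad @: [set: 'I_n * 'I_m].
  move/subset_leq_card; rewrite cardsT card_ord => /leq_trans.
  move/(_ _ (leq_imset_card _ _)); rewrite cardsT card_prod !card_ord.
  by rewrite leqNgt nm.
apply/fintype.subsetP => a _; move/(_ a)/negbT: nex; rewrite negb_forall.
case/existsP => i; rewrite -ltnNge => lt; apply/imsetP.
exists (i, Ordinal lt); rewrite ?inE // /bad.
by rewrite [_%:R](natr_Zp (p i - a)) opprB addrC subrK.
Qed.

Definition lift_cut (m : nat) p (i : 'I_n) : nat := val (p i - cut m p).

Lemma lift_cutK m p i : (lift_cut m p i)%:R = p i - cut m p.
Proof. exact: natr_Zp. Qed.

(** A relation that holds only modulo q would make the smaller coordinate drop
    below [s], hence into the [m] free cells at the cut. *)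
Lemma lift_cutE m p i j s : (n * m < q.+2)%N -> (s <= m)%N ->
  (lift_cut m p i == lift_cut m p j + s)%N = (p i == p j + s%:R).
Proof.
move=> nm sm; apply/eqP/eqP => [e|e].
  have : p i - cut m p = p j - cut m p + s%:R.
    by rewrite -!lift_cutK -natrD e.
  by rewrite addrAC => /addIr.
have li := cutP p nm i; rewrite -/(lift_cut m p i) in li.
have lti : (lift_cut m p i < q.+2)%N by exact: ltn_ord.
have ltj : (lift_cut m p j < q.+2)%N by exact: ltn_ord.
have E : lift_cut m p i = ((lift_cut m p j + s) %% q.+2)%N.
  rewrite /lift_cut e addrAC.
  by rewrite Zp_nat /= modnDmr.
case: (ltnP (lift_cut m p j + s) q.+2) => h; first by rewrite E modn_small.
move: E; rewrite -(subnK h) modnDr modn_small; lia.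
Qed.

End Lift.

(** * Flats of gain arrangements *)

Lemma sub_subK (V : zmodType) (a b c : V) : a = b + (a - c - (b - c)).
Proof. by rewrite opprB [X in b + X]addrA subrK [RHS]addrC subrK. Qed.

Section GainFlats.
Local Open Scope classical_set_scope.
Context {R : realType} {n m : nat}.
Implicit Types (A : {fset set 'rV[R]_n}) (X : set 'rV[R]_n).

(** Degenerate equations with i = j are harmless here, since a nonempty flat
    satisfies such an equation only for s = 0. *)
Definition gain_arrangement A : Prop :=
  forall H, H \in A -> exists i j s, (s <= m)%N /\ H = hyp i j s.

Section OneFlat.
Variables (A : {fset set 'rV[R]_n}) (X : set 'rV[R]_n).
Hypotheses (gA : gain_arrangement A) (XA : X \in flats A).

Definition int_point (z : 'I_n -> int) : 'rV[R]_n := \row_i (z i)%:~R.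

Lemma flat_gainP x :
  X x <-> (forall i j s, (s <= m)%N -> X `<=` hyp i j s -> hyp i j s x).
Proof.
split=> [Xx i j s _|h]; first exact.
case/flatsP: XA => B [BA XE _]; rewrite XE => H HB.
have [i [j [s [sm HE]]]] := gA (BA _ HB).
by rewrite HE; apply: h => //; rewrite XE -HE => u; apply.
Qed.

(** All equations have integer right-hand sides, so the floors of the
    coordinates of a real solution are again a solution. *)
Lemma flat_int_point : exists z, X (int_point z).
Proof.
have [x Xx] : exists x, X x by case/flatsP: XA => B [_ _ /set0P].
exists (fun i => Num.floor (x ord0 i)); apply/flat_gainP => i j s _ XH.
have := XH _ Xx; rewrite /hyp /= !mxE => /eqP; rewrite subr_eq => /eqP ->.
rewrite floorDzr; last exact: natr_int.
rewrite -[s%:R]/(s%:Z%:~R) intrKfloor.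
by rewrite intrD addrK.
Qed.

(** The pairs whose coordinate difference is constant on the flat.  Taking this
    relation instead of connectivity in the gain graph of the defining equations
    gives an equivalence for free, and its classes are the same. *)
Definition rigid (i j : 'I_n) : bool :=
  `[< exists c, forall x, X x -> x ord0 i - x ord0 j = c >].

Lemma rigid_refl i : rigid i i.
Proof. by apply/asboolP; exists 0 => x _; rewrite subrr. Qed.

Lemma rigid_sym i j : rigid i j -> rigid j i.
Proof.
by case/asboolP => c h; apply/asboolP; exists (- c) => x /h <-; rewrite opprB.
Qed.

Lemma rigid_trans i j k : rigid i j -> rigid j k -> rigid i k.
Proof.
case/asboolP => c h; case/asboolP => d h'; apply/asboolP; exists (c + d) => x Xx.
by rewrite -(h _ Xx) -(h' _ Xx) addrA subrK.
Qed.

Definition rigid_rep (i : 'I_n) : 'I_n := choose (rigid i) i.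

Lemma rigid_repP i : rigid i (rigid_rep i).
Proof. exact/chooseP/rigid_refl. Qed.

Lemma rigid_rep_eq i j : rigid i j -> rigid_rep i = rigid_rep j.
Proof.
move=> ij; rewrite /rigid_rep (@eq_choose _ _ (rigid j)) => [|k].
  by apply: choose_id => //; [exact: rigid_sym|exact: rigid_refl].
by apply/idP/idP; apply: rigid_trans => //; exact: rigid_sym.
Qed.

Definition rigid_class : predArgType := {i | rigid_rep i == i}.

Lemma rigid_class_subproof i : rigid_rep (rigid_rep i) == rigid_rep i.
Proof. by apply/eqP/esym/rigid_rep_eq/rigid_repP. Qed.

Definition class_of i : rigid_class :=
  exist _ (rigid_rep i) (rigid_class_subproof i).

Lemma class_of_val (k : rigid_class) : class_of (val k) = k.
Proof. by apply: val_inj; apply/eqP; exact: (valP k). Qed.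

Lemma class_of_eq i j : rigid i j -> class_of i = class_of j.
Proof. by move=> ij; apply/val_inj/rigid_rep_eq. Qed.

Lemma hyp_rigid i j s : X `<=` hyp i j s -> rigid i j.
Proof. by move=> XH; apply/asboolP; exists s%:R => x /XH. Qed.

Lemma rigidE i j x y : rigid i j -> X x -> X y ->
  x ord0 i - x ord0 j = y ord0 i - y ord0 j.
Proof. by case/asboolP => c h /h -> /h ->. Qed.

(** From an integer point of the flat one reaches exactly the points obtained by
    adding a vector constant on the rigidity classes. *)
Lemma affdim_flat : affdim X = #|{: rigid_class}|.
Proof.
have [z Xz] := flat_int_point; set x0 := int_point z in Xz.
(* M spreads one value per class to all vertices of the class. *)
pose M : 'M[R]_(#|{: rigid_class}|, n) :=
  \matrix_(k, i) (k == enum_rank (class_of i))%:R.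
pose f : 'Hom('rV[R]_#|{: rigid_class}|, 'rV[R]_n) := linfun (mulmxr M).
have fE v i : f v ord0 i = v ord0 (enum_rank (class_of i)).
  rewrite lfunE /= mxE (bigD1 (enum_rank (class_of i))) //= mxE eqxx mulr1.
  by rewrite big1 ?addr0 // => k /negbTE nk; rewrite mxE nk mulr0.
have -> : X = [set x0 + u | u in [set` limg f]].
  apply/seteqP; split => [x Xx|x [u /memv_imgP[v _ ->] <-]]; last first.
    apply/flat_gainP => i j s sm XH; rewrite /hyp /= 2![(_ + f v) _ _]mxE !fE.
    rewrite (class_of_eq (hyp_rigid XH)) opprD addrACA subrr addr0.
    exact: XH.
  exists (x - x0); last by rewrite addrC subrK.
  apply/memv_imgP; exists (\row_k (x - x0) ord0 (val (enum_val k))).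
    exact: memvf.
  apply/rowP => i; rewrite fE [RHS]mxE enum_rankK /=.
  have e := rigidE (rigid_repP i) Xx Xz.
  by move: e; rewrite !mxE; lra.
rewrite affdimE limg_dim_eq; first by rewrite dimvf dim_matrix; exact: mul1n.
apply/eqP; rewrite -subv0; apply: (subv_trans (capvSr _ _)); rewrite subv0.
apply/lker0P => v w e; apply/rowP => k.
have := congr1 (fun u : 'rV_n => u ord0 (val (enum_val k))) e.
by rewrite !fE class_of_val enum_valK.
Qed.

(** The description of the flat as an integer point plus the vectors constant on
    rigidity classes persists modulo q: a residue vector lies on the flat as soon
    as its coordinate differences inside each class are those of the integer
    point. *)
Lemma card_flat_points q (nm : (n * m < q.+2)%N) :
  #|[set p : {ffun 'I_n -> 'I_q.+2} |
      `[< X (int_point (fun i => (lift_cut m p i)%:Z)) >]]%SET|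
  = (q.+2 ^ affdim X)%N.
Proof.
have [z Xz] := flat_int_point.
rewrite affdim_flat -[q.+2 in RHS]card_ord -card_ffun.
pose ext (f : {ffun rigid_class -> 'I_q.+2}) : {ffun 'I_n -> 'I_q.+2} :=
  [ffun i => f (class_of i) + (z i - z (rigid_rep i))%:~R].
have ext_inj : injective ext.
  move=> f g /ffunP e; apply/ffunP => k; have := e (val k).
  by rewrite !ffunE class_of_val => /addIr.
rewrite -(card_imset _ ext_inj); apply: eq_card => p; rewrite !inE.
have pE i : (lift_cut m p i)%:Z%:~R = p i - cut m p by exact: lift_cutK.
apply/asboolP/imsetP => [Xp|[f _ pf]].
  exists [ffun k => p (val k)] => //; apply/ffunP => i; rewrite !ffunE /=.
  have := rigidE (rigid_repP i) Xp Xz; rewrite !mxE -!intrB.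
  move=> /intr_inj <-; rewrite intrB !pE.
  exact: sub_subK.
apply/flat_gainP => i j s sm XH; rewrite /hyp /= !mxE.
have ij := hyp_rigid XH.
have /eqP : p i == p j + s%:R.
  rewrite pf !ffunE (class_of_eq ij) (rigid_rep_eq ij) -addrA.
  have : z i = z j + s.
    have := XH _ Xz; rewrite /hyp /= !mxE -intrB => /eqP.
    by rewrite -[s%:R]/(s%:Z%:~R) eqr_int subr_eq addrC => /eqP.
  by move=> ->; rewrite addrAC [X in _ + X == _]intrD.
move=> e; have : (lift_cut m p i == lift_cut m p j + s)%N.
  by rewrite lift_cutE //; apply/eqP.
by move/eqP => ->; rewrite PoszD intrD addrAC subrr add0r.
Qed.

End OneFlat.
End GainFlats.

(** * Residue vectors avoiding the deleted Catalan arrangement *)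

Section Avoidance.
Local Open Scope classical_set_scope.
Context {R : realType} {n m : nat}.

Lemma hyp_lift q (p : {ffun 'I_n -> 'I_q.+2}) (i j : 'I_n) s :
  (n * m < q.+2)%N -> (s <= m)%N ->
  hyp i j s (int_point (fun i => (lift_cut m p i)%:Z) : 'rV[R]_n)
  <-> p i = p j + s%:R.
Proof.
move=> nm sm; rewrite /hyp /= !mxE.
split=> [e|/eqP]; last first.
  by rewrite -(lift_cutE p i j nm sm) => /eqP ->; rewrite PoszD intrD addrAC subrr add0r.
apply/eqP; rewrite -(lift_cutE p i j nm sm) -(eqr_nat R) natrD addrC -subr_eq.
exact/eqP.
Qed.

(** Evaluating on s e_i and - s e_j recovers the triple from the hyperplane. *)
Lemma hyp_inj (i j i' j' : 'I_n) s s' : i != j -> i' != j' -> (0 < s')%N ->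
  hyp i j s = hyp i' j' s' :> set 'rV[R]_n -> [/\ i = i', j = j' & s = s'].
Proof.
move=> ij ij' s'0 /seteqP[sub _].
have ji : (j == i) = false by rewrite eq_sym (negbTE ij).
have := sub (\row_k if k == i then s%:R else 0).
have := sub (\row_k if k == j then - s%:R else 0).
rewrite /hyp /= !mxE !eqxx ji (negbTE ij) sub0r opprK => /(_ erefl) e2.
rewrite subr0 => /(_ erefl) e1.
have s'R : (0 : R) < s'%:R by rewrite ltr0n.
have := ler0n R s.
case: (i' =P i) e1 ij' => [->|_]; case: (j' =P i) => [->|_] e1 ij' s0; try lra.
case: (j' =P j) e2 => [->|_]; last by rewrite ?(negbTE ij); case: ifP; lra.
by move: e1; rewrite subr0 => /eqP; rewrite eqr_nat => /eqP.
Qed.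

Variables (S : {set 'I_m.+1}) (A : 'I_m.+1 -> rel 'I_n).
Hypothesis (hS : forall s, s \in S -> (1 <= s)%N).
Hypothesis (hA : forall s, s \in S -> irreflexive (A s)).

Lemma deleted_arcs_neq e : e \in deleted_arcs S A -> e.1.1 != e.1.2.
Proof.
rewrite inE => /andP[sS]; apply: contraTneq => ->.
by rewrite (hA sS).
Qed.

Lemma catalanP (H : set 'rV[R]_n) : H \in catalan R n m <->
  (exists i j : 'I_n, (i < j)%N /\ H = hyp i j 0) \/
  (exists i j (s : 'I_m.+1), [/\ i != j, (1 <= s)%N & H = hyp i j s]).
Proof.
rewrite /catalan inE; split.
  case/orP => /imfsetP[e /=]; rewrite inE => he ->.
    by left; exists e.1, e.2.
  by case/andP: he => ? ?; right; exists e.1.1, e.1.2, e.2.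
case=> [[i [j [ij ->]]]|[i [j [s [ij s1 ->]]]]]; apply/orP.
  by left; apply/imfsetP; exists (i, j); rewrite ?inE.
by right; apply/imfsetP; exists (i, j, s); rewrite ?inE //=; apply/andP.
Qed.

Lemma gain_arrangement_deleted : gain_arrangement (m := m) (deleted_catalan S A R).
Proof.
move=> H; rewrite inE => /andP[_ /catalanP[[i [j [_ ->]]]|[i [j [s [_ _ ->]]]]]].
  by exists i, j, 0%N.
by exists i, j, s; split => //; rewrite -ltnS ltn_ord.
Qed.

Lemma setT_notin_deleted : setT \notin deleted_catalan S A R.
Proof.
have nT (i j : 'I_n) s : i != j -> setT <> hyp i j s :> set 'rV[R]_n.
  move=> ij /seteqP[/(_ (\row_k if k == i then s%:R + 1 else 0)) + _].
  rewrite /hyp /= !mxE eqxx eq_sym (negbTE ij) => /(_ I).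
  by lra.
apply/negP; rewrite inE => /andP[_ /catalanP[[i [j [ij]]]|[i [j [s [ij _]]]]]].
  by apply: nT; apply: contraTneq ij => ->; rewrite ltnn.
exact: nT.
Qed.

Definition arcs_of q (p : {ffun 'I_n -> 'I_q.+2}) : {set gain_arc n m} :=
  [set e : gain_arc n m | (1 <= e.2)%N && (p e.1.1 == p e.1.2 + (val e.2)%:R)].

Lemma arcs_ofP q (p : {ffun 'I_n -> 'I_q.+2}) i j (s : 'I_m.+1) :
  ((i, j, s) \in arcs_of p) = (1 <= s)%N && (p i == p j + (val s)%:R).
Proof. by rewrite inE. Qed.

Section Point.
Variables (q : nat) (p : {ffun 'I_n -> 'I_q.+2}).
Hypothesis nm : (n * m < q.+2)%N.

Lemma arcs_of_neq i j s : (i, j, s) \in arcs_of p -> i != j.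
Proof.
rewrite arcs_ofP => /andP[s1 pij]; apply: contraTneq pij => ->.
have sm : (val s <= m)%N by rewrite -ltnS ltn_ord.
rewrite -(lift_cutE p j j nm sm) -[X in X == _]addn0 eqn_add2l.
by rewrite eq_sym -lt0n.
Qed.

(** The hyperplanes of gain 0 are never deleted, which forces distinct
    coordinates; a hyperplane of positive gain determines its triple, so it is
    missing from the arrangement only if its own triple is deleted. *)
Lemma avoid_deletedP :
  (forall H, H \in deleted_catalan S A R ->
    ~ H (int_point (fun i => (lift_cut m p i)%:Z)))
  <-> injective p /\ arcs_of p \subset deleted_arcs S A.
Proof.
have sm (s : 'I_m.+1) : (s <= m)%N by rewrite -ltnS ltn_ord.
split=> [av|[pI pS] H].
  split.
    suff lt_neq (i j : 'I_n) : (i < j)%N -> p i <> p j.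
      move=> i j pij; apply: val_inj; case: (ltngtP i j) => // /lt_neq [] //.
    move=> ij pij; apply: (av (hyp i j 0)); last first.
      by apply/(hyp_lift p i j nm (leq0n m)); rewrite addr0.
    rewrite inE; apply/andP; split; last by apply/catalanP; left; exists i, j.
    apply/imfsetP => -[e /= eD] /seteqP[/(_ 0) + _].
    rewrite /hyp /= !mxE subrr => /(_ erefl) /eqP.
    rewrite eq_sym pnatr_eq0 => /eqP e0.
    by move: eD; rewrite inE => /andP[/hS]; rewrite e0.
  apply/fintype.subsetP => -[[i j] s] e.
  have ij := arcs_of_neq e.
  move: (e); rewrite arcs_ofP => /andP[s1 /eqP /(hyp_lift p i j nm (sm s)) H].
  have : hyp i j s \notin deleted_catalan S A R by apply/negP => /av; apply.
  rewrite inE negb_and negbK => /orP[|/negP[]]; last first.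
    by apply/catalanP; right; exists i, j, s.
  case/imfsetP => -[[i' j'] s'] /= eD.
  move: (eD) => /deleted_arcs_neq /= ij'.
  have s'1 : (0 < s')%N by move: eD; rewrite inE => /andP[/hS].
  by case/(hyp_inj ij ij' s'1) => -> -> /val_inj ->.
rewrite inE => /andP[nD /catalanP[[i [j [ij ->]]]|[i [j [s [ij s1 HE]]]]]].
  move/(hyp_lift p i j nm (leq0n m)); rewrite addr0 => /pI ji.
  by rewrite ji ltnn in ij.
rewrite HE => /(hyp_lift p i j nm (sm s)) /eqP pij.
case/negP: nD; apply/imfsetP; exists (i, j, s) => //=.
by apply: (fintype.subsetP pS); rewrite arcs_ofP s1.
Qed.

(** The lift to integers is one potential serving all components at once. *)
Lemma admissible_arcs_of : injective p -> arcs_of p \subset deleted_arcs S A ->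
  admissible S A (arcs_of p).
Proof.
move=> pI pS; split=> // C _; exists (fun i => (lift_cut m p i)%:Z).
have sm (s : 'I_m.+1) : (s <= m)%N by rewrite -ltnS ltn_ord.
split.
- move=> i j s; rewrite arcs_ofP -(lift_cutE _ _ _ nm (sm s)).
  by case/andP => _ /eqP -> _ _; rewrite PoszD addrAC subrr add0r.
- move=> i j _ _ [e]; apply/pI/eqP.
  by rewrite -[p j]addr0 -(lift_cutE p i j nm (leq0n m)) addn0 e.
move=> u v s _ _ _ s1 /eqP; rewrite subr_eq addrC -PoszD => /eqP[e].
by rewrite arcs_ofP s1 -(lift_cutE _ _ _ nm (sm s)) e eqxx.
Qed.

End Point.
End Avoidance.

(** * Labeled arcs on a cycle *)

Section Placements.

(** A translation class has exactly one member vanishing at [i0]. *)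
Lemma card_translation (I : finType) (G : finZmodType) (P : pred {ffun I -> G})
  (i0 : I) :
  (forall f g, P f -> P [ffun i => f i + g]) ->
  #|[set f | P f]| = (#|G| * #|[set f | P f && (f i0 == 0%R)]|)%N.
Proof.
move=> PT; pose shift (e : G * {ffun I -> G}) := [ffun i => e.2 i + e.1].
have shift_inj : {in finset.setX [set: G] [set f | P f && (f i0 == 0%R)] &,
    injective shift}.
  move=> [g f] [g' f']; rewrite !inE /= => /andP[_ /eqP f0] /andP[_ /eqP f0'] /ffunP e.
  have gg : g = g'.
    by have := e i0; rewrite !ffunE /= f0 f0' !add0r.
  congr (_, _) => //; apply/ffunP => i.
  by have := e i; rewrite !ffunE /= gg => /addIr.
rewrite -[#|G|]cardsT -cardsX -(card_in_imset shift_inj); apply: eq_card => f.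
rewrite inE; apply/idP/imsetP => [Pf|[[g h]]]; last first.
  by rewrite !inE /= => /andP[Ph _] ->; exact: PT.
exists (f i0, [ffun i => f i - f i0]).
  by rewrite !inE /= ffunE subrr eqxx andbT; exact: PT.
by apply/ffunP => i; rewrite !ffunE /= subrK.
Qed.

(** By induction: the interval starting last can be removed, and the others fit
    before its start. *)
Lemma packing (I : finType) (y c : I -> nat) (J : {set I}) (a b : nat) :
  (a <= b)%N ->
  {in J, forall i, (a <= y i)%N /\ (y i + c i < b)%N} ->
  {in J &, forall i j, i != j -> (y i + c i < y j)%N \/ (y j + c j < y i)%N} ->
  (a + \sum_(i in J) (c i).+1 <= b)%N.
Proof.
elim: {J}#|J| {-2}J (erefl #|J|) b => [|k IH] J cJ b ab range disj.
  by move/eqP: cJ; rewrite cards_eq0 => /eqP ->; rewrite big_set0 addn0.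
have [i0 i0J] : exists i0, i0 \in J by apply/card_gt0P; rewrite cJ.
case: (@arg_maxnP _ i0 (mem J) y i0J) => t tJ tmax.
have {}tJ : t \in J := tJ.
have [at_ tb] := range _ tJ.
rewrite (big_setD1 t tJ) /=.
suff : (a + \sum_(i in J :\ t) (c i).+1 <= y t)%N by lia.
apply: IH => //.
- by move: cJ; rewrite (cardsD1 t) tJ => -[].
- move=> i; rewrite !inE => /andP[it iJ]; split; first by case: (range _ iJ).
  by have := tmax i iJ; case: (disj _ _ iJ tJ it) => //= h1 h2; lia.
by move=> i j; rewrite !inE => /andP[_ iJ] /andP[_ jJ]; exact: disj.
Qed.

Section Count.
Variables (I : finType) (i0 : I) (c : I -> nat).

(** Disjoint intervals of [c i + 1] cells starting at [y i], inside a row of [q]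
    cells.  When one of them starts at 0, this also describes disjoint arcs on
    a cycle of [q] cells, cut open at the start of that arc. *)
Definition placed (q : nat) (y : {ffun I -> 'I_q}) : bool :=
  [forall i, (y i + c i < q)%N] &&
  [forall i, forall j, (i != j) ==> (y i + c i < y j)%N || (y j + c j < y i)%N].

Lemma placedP q (y : {ffun I -> 'I_q}) :
  reflect ((forall i, (y i + c i < q)%N) /\
    (forall i j, i != j -> (y i + c i < y j)%N \/ (y j + c j < y i)%N))
  (placed y).
Proof.
apply: (iffP andP) => -[/forallP h1 h2]; split => //.
  by move=> i j ij; apply/orP; move/forallP/(_ i)/forallP/(_ j)/implyP: h2; apply.
by apply/forallP => i; apply/forallP => j; apply/implyP => ij; apply/orP/h2.
Qed.

Lemma card_injections0 M :
  #|[set z : {ffun I -> 'I_M.+1} | injectiveb z && (z i0 == 0%R)]|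
  = (M ^_ #|I|.-1)%N.
Proof.
have := @card_translation I 'I_M.+1 (fun z => injectiveb z) i0.
have -> : #|[set z : {ffun I -> 'I_M.+1} | injectiveb z]| =
    (M.+1 * M ^_ #|I|.-1)%N.
  rewrite card_inj_ffuns card_ord.
  have : (0 < #|I|)%N by apply/card_gt0P; exists i0.
  by case: #|I| => // k _; rewrite ffactnS.
rewrite card_ord => /(_ _)/eqP; rewrite eqn_pmul2l // => h.
apply/esym/eqP/h => f g /injectiveP fI; apply/injectiveP => i j.
by rewrite !ffunE => /addIr /fI.
Qed.

(** The number of cells before [y i] that disappear when every interval shrinks
    to its first cell. *)
Definition below (T : nat) (y : {ffun I -> 'I_T}) (i : I) : nat :=
  \sum_(j | (y j < y i)%N) c j.

(** Shrinking every interval to its first cell is a bijection onto injective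
    placements of single cells.  Its inverse [expand] moves each cell to the
    right by the total excess length of the intervals starting before it;
    both directions preserve the order of the starting points. *)
Lemma card_placed q : (\sum_i c i < q.+1)%N ->
  #|[set y : {ffun I -> 'I_q.+1} | placed y && (y i0 == 0%R)]|
  = ((q - \sum_i c i) ^_ #|I|.-1)%N.
Proof.
rewrite ltnS; set W := (\sum_i c i)%N => Wq; rewrite -card_injections0.
pose expand (z : {ffun I -> 'I_(q - W).+1}) : {ffun I -> 'I_q.+1} :=
  [ffun i => inord (z i + below z i)].
have below_room T (z : {ffun I -> 'I_T}) i : (below z i + c i <= W)%N.
  rewrite /W (bigID (fun j => (z j < z i)%N)) /= leq_add2l.
  by rewrite (bigD1 i) ?ltnn //= leq_addr.
have expandE z i : expand z i = (z i + below z i)%N :> nat.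
  by rewrite ffunE inordK //; have := ltn_ord (z i); have := below_room _ z i; lia.
have expand_fit (z : {ffun I -> 'I_(q - W).+1}) i : (expand z i + c i < q.+1)%N.
  by rewrite expandE; have := ltn_ord (z i); have := below_room _ z i; lia.
have expand_lt (z : {ffun I -> 'I_(q - W).+1}) i j : (z i < z j)%N -> (expand z i + c i < expand z j)%N.
  move=> ij; rewrite !expandE.
  suff : (below z i + c i <= below z j)%N by lia.
  rewrite /below [leqRHS](bigID (fun k => (z k < z i)%N)) /=.
  have -> : (\sum_(k | (z k < z j) && (z k < z i)) c k)%N = below z i.
    by apply: eq_bigl => k; rewrite andb_idl // => /ltn_trans; apply.
  by rewrite leq_add2l (bigD1 i) ?ij ?ltnn //= leq_addr.
(* The order of z can be read off expand z, so z is recovered by subtraction. *)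
have expand_mono (z : {ffun I -> 'I_(q - W).+1}) i j :
    injective z -> (expand z i < expand z j)%N = (z i < z j)%N.
  move=> zI; case: (ltngtP (z i) (z j)) => [/expand_lt|/expand_lt|/val_inj/zI ->].
  - by lia.
  - by lia.
  - by rewrite ltnn.
have expand_inj : {in [set z : {ffun I -> 'I_(q - W).+1} | injectiveb z && (z i0 == 0%R)] &, injective expand}.
  move=> z z'; rewrite !inE => /andP[/injectiveP zI _] /andP[/injectiveP zI' _] e.
  apply/ffunP => i; apply: val_inj => /=.
  have := expandE z i; have := expandE z' i; rewrite e => ->.
  suff -> : below z i = below z' i by move/addIn.
  by apply: eq_bigl => j; rewrite -(expand_mono z) // e expand_mono.
rewrite -(card_in_imset expand_inj).
apply: eq_card => /= y; change {ffun I -> 'I_q.+1} in (type of y).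
rewrite inE; apply/andP/imsetP => [[/placedP[fit disj] y0]|[z]]; last first.
  rewrite inE => /andP[/injectiveP zI /eqP z0] ->; split.
    apply/placedP; split => [|i j ij]; first exact: expand_fit.
    case: (ltngtP (z i) (z j)) => [/expand_lt|/expand_lt|/val_inj/zI e].
    - by left.
    - by right.
    - by rewrite e eqxx in ij.
  apply/eqP/val_inj; rewrite /= expandE z0 /= /below big1 // => j.
  by rewrite z0 ltn0.
have disj_lt i j : (y i < y j)%N -> (y i + c i < y j)%N.
  move=> ij; have ne : i != j by apply: contraTneq ij => ->; rewrite ltnn.
  by case: (disj _ _ ne) => //; lia.
have pack a b (P : pred I) : (a <= b)%N ->
    (forall i, P i -> (a <= y i)%N /\ (y i + c i < b)%N) ->
    (a + (\sum_(i | P i) c i + #|[set i | P i]|) <= b)%N.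
  move=> ab rg.
  have -> : (\sum_(i | P i) c i + #|[set i | P i]| =
      \sum_(i in [set i | P i]) (c i).+1)%N.
    rewrite -sum1_card; under [in RHS]eq_bigr => k _ do rewrite -addn1.
    by rewrite big_split; congr (_ + _)%N; apply: eq_bigl => k; rewrite inE.
  apply: packing ab _ _ => [i|i j _ _]; last exact: disj.
  by rewrite inE; exact: rg.
have below_le i : (below y i <= y i)%N.
  have := pack 0%N (y i) (fun j => (y j < y i)%N) (leq0n _).
  rewrite add0n => h; apply: leq_trans (leq_addr _ _) (h _).
  by move=> j /disj_lt.
have pack1 a b (P : pred I) k : P k -> (a <= b)%N ->
    (forall i, P i -> (a <= y i)%N /\ (y i + c i < b)%N) ->
    (a + \sum_(i | P i) c i < b)%N.
  move=> Pk ab /(pack _ _ _ ab).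
  suff : (0 < #|[set i | P i]|)%N by lia.
  by apply/card_gt0P; exists k; rewrite inE.
(* The preimage of y: delete the tails of all intervals. *)
pose z : {ffun I -> 'I_(q - W).+1} := [ffun i => inord (y i - below y i)].
have zE i : z i = (y i - below y i)%N :> nat.
  rewrite ffunE inordK // ltnS.
  have := @pack1 (y i) q.+1 (fun j => ~~ (y j < y i)%N) i.
  rewrite ltnn => /(_ isT (ltnW (ltn_ord _))) h.
  have {}h : (y i + \sum_(j | ~~ (y j < y i)%N) c j < q.+1)%N.
    by apply: h => j; rewrite -leqNgt; split.
  have : W = (below y i + \sum_(j | ~~ (y j < y i)%N) c j)%N.
    by rewrite /W (bigID (fun j => (y j < y i)%N)).
  have := below_le i; lia.
have z_lt i j : (y i < y j)%N -> (z i < z j)%N.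
  move=> ij; rewrite !zE.
  have := @pack1 (y i) (y j) (fun k => (y k < y j)%N && ~~ (y k < y i)%N) i.
  rewrite ij ltnn => /(_ isT (ltnW ij)) h.
  have {}h : (y i + \sum_(k | (y k < y j)%N && ~~ (y k < y i)%N) c k < y j)%N.
    by apply: h => k /andP[/disj_lt kj]; rewrite -leqNgt.
  have : (below y j = below y i +
      \sum_(k | (y k < y j)%N && ~~ (y k < y i)%N) c k)%N.
    rewrite [LHS](bigID (fun k => (y k < y i)%N)) /=; congr (_ + _)%N.
    by apply: eq_bigl => k; rewrite andb_idl // => /ltn_trans; apply.
  have := below_le i; have := below_le j; lia.
have yI i j : y i = y j :> nat -> i = j.
  move=> e; apply/eqP/negPn/negP => ne.
  by case: (disj _ _ ne); rewrite e; lia.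
have z_mono i j : (z i < z j)%N = (y i < y j)%N.
  case: (ltngtP (y i) (y j)) => [/z_lt|/z_lt|/yI ->].
  - by [].
  - by lia.
  - by rewrite ltnn.
exists z.
  rewrite inE; apply/andP; split.
    apply/injectiveP => i j e; apply: yI.
    have := z_mono i j; have := z_mono j i; rewrite e ltnn.
    by case: ltngtP.
  by apply/eqP/val_inj; rewrite /= zE (eqP y0).
apply/ffunP => i; apply: val_inj => /=; rewrite expandE zE.
have -> : below z i = below y i by apply: eq_bigl => j; rewrite z_mono.
by rewrite subnK.
Qed.
End Count.
End Placements.

(** * Residue vectors with prescribed arcs *)

Section Anchored.
Context {n m : nat}.
Implicit Types (F : {set gain_arc n m}) (r : 'I_n -> 'I_n) (h w : 'I_n -> nat).

(** The combinatorial content of admissibility in normalized form: each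
    component has a base vertex [r v], where its potential [h] takes its minimum
    value 0, and [w (r v)] is its span. *)
Record anchored F r h w : Prop := Anchored {
  anchor_root : forall v, r (r v) = r v;
  anchor_connect : forall u v, (r u == r v) = connect (adjacent F) u v;
  anchor_height0 : forall v, h (r v) = 0%N;
  anchor_arc : forall i j s, (i, j, s) \in F -> (0 < s)%N /\ h i = (h j + s)%N;
  anchor_inj : forall u v, r u = r v -> h u = h v -> u = v;
  anchor_full : forall u v (s : 'I_m.+1), r u = r v -> (0 < s)%N ->
    h u = (h v + s)%N -> (u, v, s) \in F;
  anchor_width : forall v, (h v <= w (r v))%N;
  anchor_top : forall a, exists2 v, r v = r a & h v = w (r a) }.

Lemma connect_adjacent_const F (T : eqType) (f : 'I_n -> T) :
  (forall i j s, (i, j, s) \in F -> f i = f j) ->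
  forall u v, connect (adjacent F) u v -> f u = f v.
Proof.
move=> fF u v uv.
have cl : closed (adjacent F) [pred x | f u == f x].
  by move=> x y /existsP[s /orP[] /fF e]; rewrite !inE e.
by have := closed_connect cl uv; rewrite !inE eqxx => /esym/eqP.
Qed.

Section Points.
Variables (F : {set gain_arc n m}) (r : 'I_n -> 'I_n) (h w : 'I_n -> nat).
Hypothesis aF : anchored F r h w.

Definition root_vertex : predArgType := {v | r v == v}.

Lemma root_subproof v : r (r v) == r v.
Proof. by rewrite (anchor_root aF). Qed.

Definition root_of v : root_vertex := exist _ (r v) (root_subproof v).

Lemma root_of_val (a : root_vertex) : root_of (val a) = a.
Proof. by apply: val_inj; apply/eqP; exact: (valP a). Qed.

Lemma root_of_eq u v : root_of u = root_of v <-> r u = r v.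
Proof. by split=> [[]|e] //; apply: val_inj. Qed.

Lemma arc_root i j s : (i, j, s) \in F -> r i = r j.
Proof.
move=> e; apply/eqP; rewrite (anchor_connect aF); apply: connect1.
by apply/existsP; exists s; rewrite e.
Qed.

(** If no vertex of the component had its height in the window
    from [t - m] to [t], no arc could join the vertices below the window to
    those above it, since arcs change the height by at most [m].  But the base
    vertex is below and the top vertex is not. *)
Lemma anchored_gap a t : (t <= w (r a) + m)%N ->
  exists u, [/\ r u = r a, (h u <= t)%N & (t <= h u + m)%N].
Proof.
move=> tw; apply: contrapT => no.
have no' u : r u = r a -> (h u <= t)%N -> (h u + m < t)%N.
  by move=> ru hu; rewrite ltnNge; apply/negP => tu; apply: no; exists u.
pose f u := (h u <= t)%N && (r u == r a).
(* Under no', an arc cannot leave the set of vertices at height at most t. *)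
have fF i j s : (i, j, s) \in F -> f i = f j.
  move=> e; rewrite /f (arc_root e); case: eqP => [ja|_]; last by rewrite !andbF.
  rewrite !andbT; have [_ ->] := anchor_arc aF e.
  have := no' j ja; have := ltn_ord s; lia.
have [v va vw] := anchor_top aF a.
have : f (r a) = f v.
  apply: (connect_adjacent_const fF).
  by rewrite -(anchor_connect aF) (anchor_root aF) va.
rewrite /f (anchor_root aF) (anchor_height0 aF) va eqxx /= andbT => /esym hv.
by have := no' v va hv; rewrite vw; lia.
Qed.

Variables (q : nat) (v0 : 'I_n).
Let c (a : root_vertex) : nat := (w (val a) + m)%N.
Hypothesis room : (\sum_a c a < q.+2)%N.

Let realizes (p : {ffun 'I_n -> 'I_q.+2}) : bool :=
  injectiveb p && (arcs_of p == F).

(** Along each arc of [F] both [p] and [h] change by the gain. *)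
Lemma realizes_height p v : realizes p -> p v = p (r v) + (h v)%:R.
Proof.
case/andP => _ /eqP pF.
suff : p v - (h v)%:R = p (r v) - (h (r v))%:R.
  by rewrite (anchor_height0 aF) subr0 => <-; rewrite subrK.
apply: (@connect_adjacent_const F _ (fun v => p v - (h v)%:R)); last first.
  by rewrite -(anchor_connect aF) (anchor_root aF).
move=> i j s e; have [_ ->] := anchor_arc aF e.
move: e; rewrite -pF arcs_ofP => /andP[_ /eqP ->].
by rewrite natrD opprD addrACA subrr addr0.
Qed.

(** The cells from the base of a component up to [m] cells beyond its top
    contain no vertex of another component: such a vertex would lie at most [m]
    cells after some vertex of the component, by the gap property, and so be
    joined to it. *)
Lemma realizes_near p a b t : realizes p -> (t <= w (r b) + m)%N ->
  p a = p (r b) + t%:R -> r a = r b.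
Proof.
move=> gp tw pa; have [u [ru hu tu]] := anchored_gap tw.
have pu : p a = p u + (t - h u)%:R.
  by rewrite (realizes_height u gp) ru -addrA -natrD subnKC.
case/andP: gp => /injectiveP pI /eqP pF.
have sm : (t - h u < m.+1)%N by lia.
case: (posnP (t - h u)%N) pu => [->|s0 pu]; first by rewrite addr0 => /pI ->.
rewrite -ru; apply: (@arc_root _ _ (Ordinal sm)).
by rewrite -pF arcs_ofP /= s0 pu eqxx.
Qed.

(** After rotating the cycle so that the base vertex of [v0] sits at 0, a vector
    with arc set [F] is determined by the positions of the base vertices, and
    these are the placements of disjoint intervals of [w + m + 1] cells. *)
Lemma card_realizing_points :
  #|[set p : {ffun 'I_n -> 'I_q.+2} | injectiveb p && (arcs_of p == F)]|
  = (q.+2 * (q.+1 - \sum_a c a) ^_ #|{: root_vertex}|.-1)%N.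
Proof.
pose i0 := root_of v0.
rewrite -(card_placed i0 room).
rewrite (@card_translation _ 'I_q.+2 realizes (r v0)); last first.
  move=> p g /andP[/injectiveP pI /eqP pF]; apply/andP; split.
    by apply/injectiveP => i j; rewrite !ffunE => /addIr /pI.
  rewrite -pF; apply/eqP/setP => -[[i j] s]; rewrite !arcs_ofP !ffunE.
  by rewrite addrAC (inj_eq (addIr _)).
rewrite card_ord. congr (_ * _)%N.
pose ext (y : {ffun root_vertex -> 'I_q.+2}) : {ffun 'I_n -> 'I_q.+2} :=
  [ffun v => y (root_of v) + (h v)%:R].
have rE (a : root_vertex) : r (val a) = val a by apply/eqP; exact: (valP a).
have h0 (a : root_vertex) : h (val a) = 0%N by rewrite -rE (anchor_height0 aF).
have ext_inj : injective ext.
  move=> y y' /ffunP e; apply/ffunP => a; have := e (val a).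
  by rewrite !ffunE root_of_val h0 !addr0.
rewrite -(card_imset _ ext_inj).
apply: eq_card => /= p; change {ffun 'I_n -> 'I_q.+2} in (type of p).
rewrite inE; apply/andP/imsetP => [[gp /eqP p0]|[/= y]]; last first.
  change {ffun root_vertex -> 'I_q.+2} in (type of y).
  rewrite inE => /andP[/placedP[fit disj'] /eqP y0] pE.
  have disj (a b : root_vertex) : a != b ->
    (y a + c a < y b)%N \/ (y b + c b < y a)%N := @disj' a b.
  have pn v : p v = (y (root_of v) + h v)%N :> nat.
    rewrite pE ffunE Zp_nat /= modnDmr modn_small //.
    apply: leq_ltn_trans (fit (root_of v)); rewrite leq_add2l.
    exact: leq_trans (anchor_width aF v) (leq_addr _ _).
  have pns v (s : 'I_m.+1) : p v + (val s)%:R = (y (root_of v) + h v + s)%N :> nat.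
    rewrite Zp_nat /= modnDmr modn_small pn //.
    apply: leq_ltn_trans (fit (root_of v)); rewrite -addnA leq_add2l.
    by rewrite leq_add ?(anchor_width aF) // -ltnS ltn_ord.
  (* A vertex within m cells after another one lies in the same interval. *)
  have same u v s : (s <= m)%N -> p u = (p v + s)%N :> nat -> root_of u = root_of v.
    move=> sm; rewrite !pn => e; apply/eqP/negPn/negP => /disj.
    have := anchor_width aF u; have := anchor_width aF v; rewrite /c /=.
    by move=> ? ? [] ?; lia.
  split; last first.
    apply/eqP/val_inj; rewrite /= pn (anchor_height0 aF) addn0.
    have -> : root_of (r v0) = i0 by apply/root_of_eq; rewrite (anchor_root aF).
    by rewrite y0.
  apply/andP; split.
    apply/injectiveP => u v e.
    have ru : root_of u = root_of v by apply: (same u v 0%N); rewrite ?addn0 ?e.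
    apply: (anchor_inj aF); first exact/root_of_eq.
    by have := pn u; rewrite e pn ru => /addnI.
  apply/eqP/setP => -[[i j] s]; rewrite arcs_ofP.
  have sm : (s <= m)%N by rewrite -ltnS ltn_ord.
  apply/andP/idP => [[s0 /eqP e]|e].
    have {}e : p i = (p j + s)%N :> nat by rewrite e pns pn.
    have rij := same _ _ _ sm e.
    apply: (anchor_full aF) => //; first exact/root_of_eq.
    by move: e; rewrite !pn rij -addnA => /addnI.
  have [s0 hij] := anchor_arc aF e; split => //; apply/eqP/ord_inj.
  by rewrite pns pn hij addnA; congr (_ + _ + _)%N; have /root_of_eq -> := arc_root e.
have pE v : p v = p (r v) + (h v)%:R by exact: realizes_height.
case/andP: (gp) => /injectiveP pI _.
have eq_shift (a b : 'I_n) t : (p b = (p a + t) %% q.+2 :> nat)%N -> p b = p a + t%:R.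
  by move=> e; apply/val_inj; rewrite Zp_nat /= modnDmr.
exists [ffun a => p (val a)]; last first.
  by apply/ffunP => v; rewrite !ffunE /= -pE.
rewrite inE; apply/andP; split; last by rewrite ffunE /= p0.
apply/placedP; split=> [b|a b ab].
  rewrite ffunE ltnNge; apply/negP => le.
  have cb : (c b < q.+2)%N.
    by apply: leq_ltn_trans room; rewrite (bigD1 b) //= leq_addr.
  (* An interval running past the end of the row would reach cell 0 again,
     which the base vertex r v0 occupies. *)
  have rb : r (r v0) = r (val b).
    apply: (@realizes_near p _ _ (q.+2 - p (val b))) => //.
      by rewrite rE leq_subLR.
    apply: eq_shift; rewrite rE p0 subnKC ?modnn //; exact: ltnW.
  have pb0 : p (val b) = 0 by rewrite -rE -rb (anchor_root aF).
  by move: le; rewrite pb0 /=; lia.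
rewrite !ffunE.
have far (a' b' : root_vertex) : a' != b' -> (p (val a') < p (val b'))%N ->
    (p (val a') + c a' < p (val b'))%N.
  move=> ne lt; rewrite ltnNge; apply/negP => le; case/eqP: ne.
  rewrite -(root_of_val a') -(root_of_val b'); apply/root_of_eq/esym.
  apply: (@realizes_near p _ _ (p (val b') - p (val a'))) => //.
    by rewrite rE leq_subLR.
  by apply: eq_shift; rewrite rE subnKC ?(ltnW lt) // modn_small.
case: (ltngtP (p (val a)) (p (val b))) => [lt|lt|/val_inj/pI/val_inj e].
- by left; apply: far.
- by right; apply: far; rewrite 1?eq_sym.
- by rewrite e eqxx in ab.
Qed.

End Points.
End Anchored.

(** * Potentials of an admissible set of arcs *)

Section Admissible.
Context {n m : nat}.

(** The default value [head 0 vals] in the two iterated extrema is itself an entry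
    of the list, so both extrema are attained. *)
Lemma spreadP (phi : 'I_n -> int) (C : {set 'I_n}) v : v \in C ->
  exists a b, [/\ a \in C, b \in C, spread phi C = phi b - phi a &
    {in C, forall x, phi a <= phi x <= phi b}].
Proof.
move=> vC; rewrite /spread; set s := [seq phi v | v in C].
have sE x : x \in s -> exists2 u, u \in C & phi u = x.
  by case/mapP => u; rewrite mem_enum => uC ->; exists u.
have Cs u : u \in C -> phi u \in s by move=> uC; apply: map_f; rewrite mem_enum.
have hs : head 0 s \in s.
  by have := Cs _ vC; case: (s) => //= x s' _; rewrite inE eqxx.
have [b bC bE] : exists2 u, u \in C &
    phi u = \big[Order.max/head 0 s]_(x <- s) x.
  apply: sE; rewrite big_seq; apply: (big_ind (fun x => x \in s)) => // x y xs ys.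
  by rewrite /Order.max; case: ifP.
have [a aC aE] : exists2 u, u \in C &
    phi u = \big[Order.min/head 0 s]_(x <- s) x.
  apply: sE; rewrite big_seq; apply: (big_ind (fun x => x \in s)) => // x y xs ys.
  by rewrite /Order.min; case: ifP.
exists a, b; split=> // [|x xC]; first by rewrite aE bE.
rewrite aE bE; apply/andP; split.
  exact: (@ge_bigmin_seq _ _ _ _ _ (phi x) predT id (Cs _ xC)).
exact: (@le_bigmax_seq _ _ _ _ _ (phi x) predT id (Cs _ xC)).
Qed.

Variables (S : {set 'I_m.+1}) (A : 'I_m.+1 -> rel 'I_n).
Hypothesis hS : forall s, s \in S -> (1 <= s)%N.
Variable F : {set gain_arc n m}.
Hypothesis admF : admissible S A F.

Let E := connect (adjacent F).

Lemma connect_adjacent_sym : connect_sym (adjacent F).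
Proof.
apply: sym_connect_sym => i j; apply/existsP/existsP => -[s]; rewrite orbC; by exists s.
Qed.

(** Written so as to be convertible to a block of [equivalence_partition]. *)
Definition wcomp (v : 'I_n) : {set 'I_n} := [set u in [set: 'I_n] | E v u].

Lemma in_wcomp u v : (u \in wcomp v) = E v u.
Proof. by rewrite !inE. Qed.

Lemma mem_wcomp u v : E u v -> u \in wcomp v.
Proof. by rewrite in_wcomp /E connect_adjacent_sym. Qed.

Lemma wcomp_eq u v : E u v -> wcomp u = wcomp v.
Proof.
move=> uv; apply/setP => x; rewrite !in_wcomp.
exact: (same_connect connect_adjacent_sym uv).
Qed.

Lemma wcomp_wcomponents v : wcomp v \in wcomponents F.
Proof. by apply/imsetP; exists v. Qed.

Lemma arc_connect i j s : (i, j, s) \in F -> E i j.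
Proof. by move=> e; apply: connect1; apply/existsP; exists s; rewrite e. Qed.

(** The potential selected by [wspan], so that spans need no transport between
    potentials. *)
Definition wcomp_potential (v : 'I_n) : 'I_n -> int :=
  xget (fun=> 0) (potential F (wcomp v)).

(** The difference of two potentials is constant along arcs; it is extended by 0
    outside the component, so that connectivity in the whole graph applies. *)
Lemma potential_unique C phi psi u v : C \in wcomponents F ->
  potential F C phi -> potential F C psi -> u \in C -> v \in C ->
  phi u - phi v = psi u - psi v.
Proof.
case/imsetP => x _ -> pphi ppsi; rewrite -/(wcomp x) !in_wcomp => xu xv.
have uv : E u v by apply: connect_trans xv; rewrite connect_adjacent_sym.
pose f y := if y \in wcomp x then phi y - psi y else 0.
have /(_ u v uv) : forall u v, E u v -> f u = f v.
  apply: connect_adjacent_const => i j s e.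
  have ij := arc_connect e.
  have xij : (i \in wcomp x) = (j \in wcomp x).
    by rewrite !in_wcomp; exact: (same_connect_r connect_adjacent_sym ij).
  rewrite /f xij; case: ifP => // jx.
  have ix : i \in wcomp x by rewrite xij.
  by have := pphi _ _ _ e ix jx; have := ppsi _ _ _ e ix jx; lia.
by rewrite /f !in_wcomp xu xv; lia.
Qed.

(** Admissibility provides some potential with the required properties; they
    only involve differences, hence pass to the selected one. *)
Lemma wcomp_potentialP v :
  [/\ potential F (wcomp v) (wcomp_potential v),
      {in wcomp v &, injective (wcomp_potential v)} &
      forall x y (s : 'I_m.+1), x \in wcomp v -> y \in wcomp v -> (0 < s)%N ->
        wcomp_potential v x - wcomp_potential v y = s%:Z -> (x, y, s) \in F].
Proof.
have [_ /(_ _ (wcomp_wcomponents v)) [phi [pphi iphi fphi]]] := admF.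
have pc : potential F (wcomp v) (wcomp_potential v).
  by apply: (@xgetPex _ (fun=> 0) (potential F (wcomp v))); exists phi.
have eqd := potential_unique (wcomp_wcomponents v) pc pphi.
split=> // [x y xC yC e|x y s xC yC s0].
  by apply: iphi => //; have := eqd x y xC yC; rewrite e; lia.
rewrite eqd // => e; apply: fphi => //.
by apply: contraTneq s0 => xy; move: e; rewrite xy subrr; case: (s) => -[].
Qed.

Definition wcomp_root (v : 'I_n) : 'I_n :=
  [arg min_(u < v | u \in wcomp v) wcomp_potential v u]%O.

Definition wcomp_height (v : 'I_n) : nat :=
  `|wcomp_potential v v - wcomp_potential v (wcomp_root v)|%N.

Definition wcomp_width (v : 'I_n) : nat := `|wspan F (wcomp v)|%N.

Lemma wcomp_refl v : v \in wcomp v.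
Proof. by rewrite in_wcomp; exact: connect0. Qed.

Lemma wcomp_rootP v : wcomp_root v \in wcomp v /\
  {in wcomp v, forall x, wcomp_potential v (wcomp_root v) <= wcomp_potential v x}.
Proof. by rewrite /wcomp_root; case: arg_minP => [|i iC imin]; first exact: wcomp_refl. Qed.

Lemma wcomp_potential_eq u v : E u v -> wcomp_potential u = wcomp_potential v.
Proof. by move=> /wcomp_eq uv; rewrite /wcomp_potential uv. Qed.

Lemma wcomp_root_eq u v : E u v -> wcomp_root u = wcomp_root v.
Proof.
move=> uv; have [_ inj _] := wcomp_potentialP v.
have [ru mu] := wcomp_rootP u; have [rv mv] := wcomp_rootP v.
rewrite (wcomp_eq uv) (wcomp_potential_eq uv) in ru mu.
by apply: inj => //; apply/le_anti; rewrite mu // mv.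
Qed.

Lemma connect_wcomp_root v : E v (wcomp_root v).
Proof. by have [] := wcomp_rootP v; rewrite in_wcomp. Qed.

Lemma wcomp_heightE v :
  (wcomp_height v)%:Z = wcomp_potential v v - wcomp_potential v (wcomp_root v).
Proof. by rewrite gez0_abs // subr_ge0; have [_] := wcomp_rootP v; apply; exact: wcomp_refl. Qed.

Lemma wspanP v : exists t,
  [/\ t \in wcomp v,
      wspan F (wcomp v) = wcomp_potential v t - wcomp_potential v (wcomp_root v) &
      {in wcomp v, forall x, wcomp_potential v x <= wcomp_potential v t}].
Proof.
have [a [b [aC bC sE ab]]] := spreadP (wcomp_potential v) (wcomp_refl v).
have [rC rmin] := wcomp_rootP v.
have ra : wcomp_potential v (wcomp_root v) = wcomp_potential v a.
  by apply/le_anti; rewrite rmin //=; case/andP: (ab _ rC).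
exists b; split => // [|x /ab /andP[] //].
by rewrite ra -sE.
Qed.

Lemma wcomp_widthE v : (wcomp_width v)%:Z = wspan F (wcomp v).
Proof.
have [t [tC wE _]] := wspanP v; have [_ rmin] := wcomp_rootP v.
by rewrite gez0_abs // wE subr_ge0 rmin.
Qed.

(** Heights are measured from the vertex of least potential, which is unique in
    its component because the potential is injective there. *)
Lemma admissible_anchored : anchored F wcomp_root wcomp_height wcomp_width.
Proof.
have sub i j s : (i, j, s) \in F -> (0 < s)%N.
  by case: admF => /fintype.subsetP FD _ /FD; rewrite inE => /andP[/hS].
have rootE u v : (wcomp_root u == wcomp_root v) = E u v.
  apply/eqP/idP => [e|]; last exact: wcomp_root_eq.
  apply: connect_trans (connect_wcomp_root u) _.
  by rewrite e connect_adjacent_sym; exact: connect_wcomp_root.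
have rr v : wcomp_root (wcomp_root v) = wcomp_root v.
  by apply/esym/wcomp_root_eq/connect_wcomp_root.
have heq u v : wcomp_root u = wcomp_root v -> E u v by move/eqP; rewrite rootE.
have hd u v : E u v -> wcomp_potential v u - wcomp_potential v v =
    (wcomp_height u)%:Z - (wcomp_height v)%:Z.
  move=> uv; rewrite !wcomp_heightE (wcomp_potential_eq uv) (wcomp_root_eq uv).
  by rewrite opprB addrA subrK.
split=> //.
- by move=> v; apply/eqP; rewrite -eqz_nat wcomp_heightE rr subrr.
- move=> i j s e; split; first exact: sub e.
  have ij := arc_connect e; have [p _ _] := wcomp_potentialP j.
  have := p _ _ _ e (mem_wcomp ij) (wcomp_refl j); rewrite hd //.
  by lia.
- move=> u v /heq uv e; have [_ inj _] := wcomp_potentialP v.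
  apply: inj; rewrite ?wcomp_refl ?mem_wcomp //.
  by have := hd _ _ uv; rewrite e; lia.
- move=> u v s /heq uv s0 e; have [_ _ full] := wcomp_potentialP v.
  apply: full; rewrite ?wcomp_refl ?mem_wcomp //.
  by rewrite hd // e; lia.
- move=> v; have vr := connect_wcomp_root v.
  have -> : wcomp_width (wcomp_root v) = wcomp_width v.
    by rewrite /wcomp_width (wcomp_eq vr).
  have [t [_ wE /(_ v (wcomp_refl v)) tv]] := wspanP v.
  by have := wcomp_heightE v; have := wcomp_widthE v; lia.
- move=> a; have ar := connect_wcomp_root a.
  have -> : wcomp_width (wcomp_root a) = wcomp_width a.
    by rewrite /wcomp_width (wcomp_eq ar).
  have [t [ta wE _]] := wspanP a; rewrite in_wcomp in ta.
  exists t; first by rewrite (wcomp_root_eq ta).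
  have := wcomp_heightE t; rewrite -(wcomp_potential_eq ta) -(wcomp_root_eq ta).
  by have := wcomp_widthE a; lia.
Qed.

Lemma wcomponents_roots :
  wcomponents F = wcomp @: [set v | wcomp_root v == v].
Proof.
apply/setP => C; apply/imsetP/imsetP => -[v vr ->]; last by exists v.
exists (wcomp_root v); last exact/wcomp_eq/connect_wcomp_root.
by rewrite inE; apply/eqP/esym/wcomp_root_eq/connect_wcomp_root.
Qed.

Lemma wcomp_inj : {in [set v | wcomp_root v == v] &, injective wcomp}.
Proof.
move=> u v; rewrite !inE => /eqP ru /eqP rv e.
rewrite -ru -rv; apply: wcomp_root_eq.
by rewrite -in_wcomp e wcomp_refl.
Qed.

Lemma nb_components_roots : nb_components F = #|{: root_vertex wcomp_root}|.
Proof.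
rewrite /nb_components wcomponents_roots (card_in_imset wcomp_inj) card_sig.
by apply: eq_card => v; rewrite !inE.
Qed.

Lemma total_span_roots :
  total_span F = (\sum_(a : root_vertex wcomp_root) wcomp_width (val a))%N%:Z.
Proof.
rewrite /total_span wcomponents_roots (big_imset _ wcomp_inj) /=.
rewrite -(big_sub (fun v => wcomp_root v == v) wcomp_width).
rewrite -[RHS]intz sumMz; apply: eq_big => v; first by rewrite inE.
by rewrite inE => _; rewrite intz wcomp_widthE.
Qed.

End Admissible.

(** * Comparison of the two polynomials *)

Lemma ffactr_nat (k r : nat) : ffactr (k%:R : int) r = (k ^_ r)%:R.
Proof.
rewrite /ffactr; elim: r => [|r IH]; first by rewrite big_ord0 ffactn0.
rewrite big_ord_recr /= IH ffactnSr natrM.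
have [rk|kr] := leqP r k; first by rewrite natrB.
by rewrite ffact_small // !mul0r.
Qed.

Lemma horner_ffactr (P : {poly int}) r x : (ffactr P r).[x] = ffactr P.[x] r.
Proof.
rewrite /ffactr horner_prod; apply: eq_bigr => i _.
by rewrite hornerD hornerN -polyC_natr hornerC.
Qed.

Section Evaluation.
Variables (R : realType) (n m : nat) (S : {set 'I_m.+1}) (A : 'I_m.+1 -> rel 'I_n).
Hypothesis hn : (1 <= n)%N.
Hypothesis hS : forall s, s \in S -> (1 <= s)%N.
Hypothesis hA : forall s, s \in S -> irreflexive (A s).

(** Every vector avoiding the arrangement has distinct coordinates and an
    admissible arc set, and conversely; so the count splits over that set. *)
Lemma charpoly_deletedE q : (n * m < q.+2)%N ->
  (charpoly (deleted_catalan S A R)).[q.+2%:R] =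
  \sum_(F : {set gain_arc n m} | `[< admissible S A F >])
    #|[set p : {ffun 'I_n -> 'I_q.+2} | injectiveb p && (arcs_of p == F)]|%:R.
Proof.
move=> nm.
rewrite (@charpoly_count _ _ _ {ffun 'I_n -> 'I_q.+2}
  (fun p => int_point (fun i => (lift_cut m p i)%:Z)) q.+2); first last.
- move=> X XA; exact: card_flat_points (@gain_arrangement_deleted _ _ _ S A) XA _ nm.
- exact: setT_notin_deleted.
rewrite -natr_sum; congr (_%:R).
set L := [set p | _].
have LP p : p \in L = injectiveb p && `[< admissible S A (arcs_of p) >].
  rewrite inE; apply/asboolP/andP.
    move/(avoid_deletedP hS hA p nm) => [pI pS]; split; first exact/injectiveP.
    by apply/asboolP; exact: admissible_arcs_of.
  case=> /injectiveP pI /asboolP[pS _].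
  exact/(avoid_deletedP hS hA p nm).
rewrite -sum1_card (partition_big (fun p => arcs_of p) (fun F => `[< admissible S A F >])) /=.
  apply: eq_bigr => F admF; rewrite -sum1_card; apply: eq_bigl => p.
  rewrite LP inE; case: eqP => [->|_]; last by rewrite !andbF.
  by rewrite admF !andbT.
by move=> p; rewrite LP => /andP[].
Qed.

Lemma card_admissible_points F q : admissible S A F ->
  (`|total_span F| + m * nb_components F < q.+2)%N ->
  #|[set p : {ffun 'I_n -> 'I_q.+2} | injectiveb p && (arcs_of p == F)]|%:R
  = q.+2%:R * ffactr (q.+2%:R - total_span F - (m * nb_components F)%:R - 1)
      (nb_components F).-1 :> int.
Proof.
move=> admF room.
have aF := admissible_anchored hS admF.
have Wc : (\sum_(a : root_vertex (wcomp_root F)) (wcomp_width F (val a) + m) =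
    `|total_span F| + m * nb_components F)%N.
  rewrite big_split /= sum_nat_const (total_span_roots admF) (nb_components_roots admF).
  by rewrite mulnC.
rewrite (card_realizing_points aF (Ordinal hn)) ?Wc // natrM; congr (_ * _).
rewrite -(nb_components_roots admF) -ffactr_nat; congr ffactr.
have : (0 <= total_span F) by rewrite (total_span_roots admF).
by move: room; lia.
Qed.

End Evaluation.

Theorem theorem3 (R : realType) (n m : nat) (hn : (1 <= n)%N) (hm : (1 <= m)%N)
    (S : {set 'I_m.+1}) (hS : forall s, s \in S -> (1 <= s)%N)
    (A : 'I_m.+1 -> rel 'I_n) (hA : forall s, s \in S -> irreflexive (A s)) :
  charpoly (deleted_catalan S A R) =
  'X * \sum_(F : {set gain_arc n m} | `[< admissible S A F >])
         ffactr ('X - (total_span F)%:P - (m * nb_components F)%:R - 1)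
                (nb_components F).-1.
Proof.
pose room (F : {set gain_arc n m}) := (`|total_span F| + m * nb_components F)%N.
(* A modulus of the form q.+2 makes the residues a nonzero ring. *)
apply: (@poly_eq_large _ _ (n * m + \sum_F room F).+2) => -[|[|q]] //.
rewrite !ltnS => Nq.
rewrite charpoly_deletedE //; last by lia.
rewrite hornerM hornerX horner_sum mulr_sumr; apply: eq_bigr => F /asboolP admF.
rewrite (card_admissible_points hn hS admF); last first.
  suff : (room F <= \sum_F room F)%N by rewrite -/(room F); lia.
  by rewrite (bigD1 F) //= leq_addr.
rewrite horner_ffactr; congr (_ * ffactr _ _).
by rewrite !hornerD !hornerN hornerX !hornerC -polyC_natr hornerC.
Qed.
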